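(* Let $M$ be a loopless matroid of rank $r$ with $n$ elements that is not the free matroid $U_{n,n}$. Let $C(M)$ be the hypergraph whose vertices are the elements of $M$ and whose hyperedges are the circuits of $M$. Then $hc(C(M))=r+1$.
   Context: All matroids and hypergraphs are finite. For an integer $t\ge 1$, a $t$-colouring of a hypergraph $H=(V,E)$ is a surjective function $\phi:V\to\{1,\dots,t\}$ (all colours must be used). A $t$-colouring $\phi$ is heterochromatic if there is a hyperedge $e\in E$ whose vertices receive pairwise distinct colours under $\phi$ (a totally multicoloured hyperedge). The heterochromatic number $hc(H)$ is the minimum $t\ge 1$ such that every $t$-colouring of $H$ is heterochromatic. $U_{k,n}$ denotes the uniform matroid of rank $k$ on $n$ elements. *)

(* Defs.v *)
From mathcomp Require Import all_boot.

Set Implicit Arguments.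
Unset Strict Implicit.
Unset Printing Implicit Defensive.

Record hypergraph (V : finType) := Hypergraph { hyperedges : {set {set V}} }.

Section Heterochromatic.

Variables (V : finType) (H : hypergraph V).

(* The colours 1, ..., t are represented by the t elements of 'I_t. *)
Definition colouring (t : nat) (phi : {ffun V -> 'I_t}) : bool :=
  [forall c, exists v, phi v == c].

Definition heterochromatic (t : nat) (phi : {ffun V -> 'I_t}) : bool :=
  [exists e in hyperedges H, dinjectiveb phi (mem e)].

Definition forces_heterochromatic (t : nat) : bool :=
  (0 < t) && [forall phi : {ffun V -> 'I_t}, colouring phi ==> heterochromatic phi].

(* There are no colourings with more than #|V| colours, so the minimum exists. *)
Lemma forces_heterochromatic_ex : exists t, forces_heterochromatic t.
Proof.
exists #|V|.+1; apply/andP; split=> //.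
apply/forallP => phi; apply/implyP => /forallP surj_phi; exfalso.
have sub : 'I_#|V|.+1 \subset codom phi.
  by apply/subsetP => c _; have /existsP[v /eqP <-] := surj_phi c; exact: codom_f.
have := leq_trans (subset_leq_card sub) (leq_image_card phi V).
by rewrite card_ord ltnn.
Qed.

Definition hc : nat := ex_minn forces_heterochromatic_ex.

End Heterochromatic.

Record matroid (T : finType) := Matroid {
  indep : {set {set T}};
  indep0 : set0 \in indep;
  indep_sub : forall I J : {set T}, J \in indep -> I \subset J -> I \in indep;
  indep_aug : forall I J : {set T}, I \in indep -> J \in indep -> #|I| < #|J| ->
    exists2 x, x \in J :\: I & x |: I \in indep
}.

Section MatroidNotions.

Variables (T : finType) (M : matroid T).

Definition rank : nat := \max_(I in indep M) #|I|.

Definition circuit (C : {set T}) : bool := minset [pred A | A \notin indep M] C.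

Definition loop (x : T) : bool := circuit [set x].

Definition loopless : Prop := forall x, ~~ loop x.

Definition circuit_hypergraph : hypergraph T := Hypergraph [set C | circuit C].

End MatroidNotions.

Definition matroid_isomorphic (T T' : finType) (M : matroid T) (M' : matroid T') : Prop :=
  exists2 f : T -> T', bijective f &
    forall A : {set T}, (f @: A \in indep M') = (A \in indep M).

Section Uniform.

Variables k n : nat.

Definition uniform_indep : {set {set 'I_n}} := [set A : {set 'I_n} | #|A| <= k].

Lemma uniform_indep0 : set0 \in uniform_indep.
Proof. by rewrite inE cards0. Qed.

Lemma uniform_indep_sub (I J : {set 'I_n}) :
  J \in uniform_indep -> I \subset J -> I \in uniform_indep.
Proof. by rewrite !inE => Jk /subset_leq_card IJ; exact: leq_trans IJ Jk. Qed.

Lemma uniform_indep_aug (I J : {set 'I_n}) :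
  I \in uniform_indep -> J \in uniform_indep -> #|I| < #|J| ->
  exists2 x, x \in J :\: I & x |: I \in uniform_indep.
Proof.
rewrite !inE => _ Jk ltIJ.
have /subsetPn[x xJ xI] : ~~ (J \subset I).
  by apply: contraL ltIJ => /subset_leq_card; rewrite -leqNgt.
by exists x; rewrite !inE ?xI ?xJ // cardsU1 xI; exact: leq_trans Jk.
Qed.

(* U_(k,n), meaningful for k <= n: for k > n the rank is n rather than k. *)
Definition uniform_matroid : matroid 'I_n :=
  Matroid uniform_indep0 uniform_indep_sub uniform_indep_aug.

End Uniform.

(* Main.v *)
Require Import Defs.
From mathcomp Require Import all_boot.

Set Implicit Arguments.
Unset Strict Implicit.
Unset Printing Implicit Defensive.

(** Upper bound: given a colouring with [rank M + 1] colours, pick one element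
    of each colour.  This transversal is too large to be independent, so it
    contains a circuit, whose elements have distinct colours.

    Lower bound: take a basis [b_0, b_1, ...] and the chain of flats spanned by
    its prefixes, and colour each element by the step at which it enters the
    chain; to use only [t <= rank M] colours, everything entering from step
    [t - 1] on gets the last colour.  All [t] colours occur because [b_j] enters
    at step [j].  If a circuit were totally multicoloured, its element [e] of
    largest colour would be its only element outside the flat reached just
    before [e] enters.  But a circuit never leaves a flat in exactly one
    element ([circuit_exits_span_twice]), since [e] is spanned by the rest of
    the circuit.  Looplessness enters at the start of the chain: the flat
    spanned by the empty set must be empty. *)

Section MatroidFacts.

Variables (T : finType) (M : matroid T).
Implicit Types (A B C I J : {set T}) (e x : T).

Lemma indep_card_le_rank I : I \in indep M -> #|I| <= rank M.
Proof. by move=> indI; exact: leq_bigmax_cond. Qed.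

Lemma exists_basis : exists2 B, B \in indep M & #|B| = rank M.
Proof.
have [|B indB eB] := @eq_bigmax_cond _ (mem (indep M)) (fun I => #|I|).
  by apply/card_gt0P; exists set0; exact: indep0.
by exists B; rewrite // -eB.
Qed.

Lemma dependent_has_circuit A :
  A \notin indep M -> exists2 C, circuit M C & C \subset A.
Proof.
move=> depA.
by have [|C ? ?] := @minset_exists _ [pred I | I \notin indep M] A; last exists C.
Qed.

Lemma circuitD1_indep C e : circuit M C -> e \in C -> C :\ e \in indep M.
Proof.
move=> /minsetP[_ minC] eC; apply/negPn/negP => dep.
by have /setP/(_ e) := minC _ dep (subD1set _ _); rewrite !inE eqxx eC.
Qed.

Lemma indep_extend I J : I \in indep M -> J \in indep M ->
  exists K, [/\ K \in indep M, I \subset K, K \subset I :|: J & #|J| <= #|K|].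
Proof.
move=> indI indJ; pose P K := [&& K \in indep M, I \subset K & K \subset I :|: J].
have PI : P I by rewrite /P indI subxx subsetUl.
(* A largest admissible set cannot be augmented from [J]. *)
case: (arg_maxnP (fun K : {set T} => #|K|) PI) => K /and3P[indK IK KIJ] maxK.
exists K; split=> //; rewrite leqNgt; apply/negP => ltKJ.
have [x /setDP[xJ xK] indxK] := indep_aug indK indJ ltKJ.
suff /maxK : P (x |: K) by rewrite /= cardsU1 xK add1n ltnn.
rewrite /P indxK (subset_trans IK (subsetUr _ _)) subUset KIJ sub1set.
by rewrite inE xJ orbT.
Qed.

(** For independent [A], this is membership in the closure of [A]. *)
Definition spanned A x := (x \in A) || (x |: A \notin indep M).

Lemma spannedS A B x : A \subset B -> spanned A x -> spanned B x.
Proof.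
move=> sAB /orP[/(subsetP sAB) xB | dep]; apply/orP; [by left | right].
by apply: contra dep => indB; exact: indep_sub indB (setUS _ sAB).
Qed.

Lemma loopless_spanned0 x : loopless M -> ~~ spanned set0 x.
Proof.
move=> /(_ x) noloop; rewrite /spanned inE setU0 /=; apply: contra noloop => dep.
apply/minsetP; split=> // A depA; rewrite subset1 => /orP[/eqP-> //|/eqP A0].
by move: depA; rewrite /= A0 indep0.
Qed.

(** If the rest of [C] were spanned by [A], then so would [e] be.  To see it by
    augmentation alone, enlarge [C :\ e] inside [C :|: A] to an independent set
    [K] with more elements than [A]; as [K] cannot contain [e], an element that
    augments [A] from [K] lies in [C :\ e] and is not spanned by [A]. *)
Lemma circuit_exits_span_twice A C e :
  A \in indep M -> circuit M C -> e \in C -> ~~ spanned A e ->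
  exists2 x, x \in C :\ e & ~~ spanned A x.
Proof.
move=> indA circC eC; rewrite negb_or negbK => /andP[eA indeA].
have [K [indK CK KCA leK]] := indep_extend (circuitD1_indep circC eC) indeA.
have eK : e \notin K.
  have /minsetP[/= depC _] := circC.
  apply: contra depC => eK; apply: indep_sub indK _.
  by rewrite -(setD1K eC) subUset sub1set eK.
have ltAK : #|A| < #|K| by rewrite cardsU1 eA in leK.
have [x /setDP[xK xA] indxA] := indep_aug indA indK ltAK.
exists x; last by rewrite negb_or xA negbK.
have := subsetP KCA x xK; rewrite in_setU in_setU1 (negPf xA) orbF.
by case/orP=> // /eqP xe; rewrite -xe xK in eK.
Qed.

Lemma transversal_heterochromatic (phi : {ffun T -> 'I_(rank M).+1}) :
  colouring phi -> heterochromatic (circuit_hypergraph M) phi.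
Proof.
move=> /forallP surj.
have surjE c : exists v, phi v == c by exact/existsP.
pose f c := xchoose (surjE c).
have fK : cancel f phi by move=> c; exact/eqP/(xchooseP (surjE c)).
have [|C circC sCS] := @dependent_has_circuit (f @: setT).
  apply/negP => /indep_card_le_rank.
  by rewrite (card_imset _ (can_inj fK)) cardsT card_ord ltnn.
apply/existsP; exists C; rewrite inE circC; apply/dinjectiveP => x y xC yC.
have /imsetP[c _ ->] := subsetP sCS x xC.
by have /imsetP[d _ ->] := subsetP sCS y yC; rewrite !fK => ->.
Qed.

Section ChainColouring.

Variables (bs : seq T) (s : nat).

Definition prefix_set i : {set T} := [set x in take i bs].

Lemma prefix_setS i j : i <= j -> prefix_set i \subset prefix_set j.
Proof.
move=> le_ij; apply/subsetP => x; rewrite !inE.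
by rewrite -(take_takel bs le_ij) => /mem_take.
Qed.

(** The prefix of length [0] is left out, as it spans nothing in a loopless
    matroid; the default value [s] of [find] is the last of the [s + 1]
    colours. *)
Definition entry_step x := find (fun i => spanned (prefix_set i.+1) x) (iota 0 s).

Lemma entry_step_lt x : entry_step x < s.+1.
Proof. by rewrite ltnS -[leqRHS](size_iota 0) find_size. Qed.

Definition chain_colouring : {ffun T -> 'I_s.+1} :=
  [ffun x => Ordinal (entry_step_lt x)].

Lemma entry_step_spanned x j : entry_step x < j -> j <= s ->
  spanned (prefix_set j) x.
Proof.
move=> ltxj lejs; apply: spannedS (prefix_setS ltxj) _.
have ltxs := leq_trans ltxj lejs.
have /(nth_find 0) : has (fun i => spanned (prefix_set i.+1) x) (iota 0 s).
  by rewrite has_find size_iota.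
by rewrite -/(entry_step x) nth_iota.
Qed.

Lemma entry_step_not_spanned x j : loopless M -> j <= entry_step x ->
  ~~ spanned (prefix_set j) x.
Proof.
move=> noloop; case: j => [_ | j ltjx].
  have ->: prefix_set 0 = set0 by apply/setP => y; rewrite !inE take0.
  exact: loopless_spanned0.
have := before_find 0 ltjx; rewrite nth_iota ?add0n => [-> // |].
by rewrite (leq_trans ltjx) // -ltnS entry_step_lt.
Qed.

Hypothesis indep_bs : [set x in bs] \in indep M.

Lemma prefix_set_indep i : prefix_set i \in indep M.
Proof.
by apply: indep_sub indep_bs _; apply/subsetP => x; rewrite !inE => /mem_take.
Qed.

Lemma entry_step_nth x0 j : uniq bs -> j < size bs -> j <= s ->
  entry_step (nth x0 bs j) = j.
Proof.
move=> Ubs ltj lejs; set b := nth x0 bs j.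
have bP i : j < i -> b \in prefix_set i.
  by move=> ltji; rewrite inE in_take ?mem_nth // index_uniq //.
apply/eqP; rewrite eqn_leq; apply/andP; split.
  rewrite leqNgt; apply/negP => ltjb; have := before_find 0 ltjb.
  rewrite nth_iota ?add0n /spanned ?bP //.
  by rewrite (leq_trans ltjb) // -ltnS entry_step_lt.
rewrite leqNgt; apply/negP => ltbj.
have := entry_step_spanned ltbj lejs; rewrite /spanned inE.
rewrite in_take ?mem_nth // index_uniq // ltnn /= => /negP[].
apply: indep_sub (prefix_set_indep j.+1) _.
by rewrite subUset sub1set bP // prefix_setS.
Qed.

Lemma chain_colouring_surjective :
  uniq bs -> s < size bs -> colouring chain_colouring.
Proof.
move=> Ubs lts; apply/forallP => c; apply/existsP.
have x0 : T by case: (bs) lts.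
have lecs : c <= s by rewrite -ltnS ltn_ord.
exists (nth x0 bs c).
by rewrite ffunE -val_eqE /= entry_step_nth // (leq_ltn_trans lecs).
Qed.

(** In a totally multicoloured circuit, every element other than the one of
    largest colour is spanned by the prefix that just misses that element. *)
Lemma chain_colouring_not_heterochromatic :
  loopless M -> ~~ heterochromatic (circuit_hypergraph M) chain_colouring.
Proof.
move=> noloop; apply/existsP => -[C /andP[]]; rewrite inE => circC.
move=> /dinjectiveP inj_phi.
have [x0 x0C] : exists x, x \in C.
  apply/set0Pn; have /minsetP[/= depC _] := circC.
  by apply: contra depC => /eqP->; exact: indep0.
case: (arg_maxnP entry_step x0C) => e eC max_e.
have les : entry_step e <= s by rewrite -ltnS entry_step_lt.
have outer := entry_step_not_spanned noloop (leqnn (entry_step e)).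
have [x /setD1P[xe xC]] :=
  circuit_exits_span_twice (prefix_set_indep _) circC eC outer.
case/negP; apply: entry_step_spanned les; rewrite ltn_neqAle [_ <= _]max_e // andbT.
apply: contra xe => /eqP eq_step; apply/eqP; apply: inj_phi => //.
by rewrite !ffunE; exact: val_inj.
Qed.

End ChainColouring.

Lemma not_forces_heterochromatic_le_rank t : loopless M -> t <= rank M ->
  ~~ forces_heterochromatic (circuit_hypergraph M) t.
Proof.
case: t => [//|s] noloop lts; have [B indB cardB] := exists_basis.
have indep_enumB : [set x in enum B] \in indep M.
  by have ->: [set x in enum B] = B by apply/setP => x; rewrite inE mem_enum.
apply/nandP; right; apply/forallPn; exists (chain_colouring (enum B) s).
rewrite negb_imply chain_colouring_not_heterochromatic // andbT.
by rewrite chain_colouring_surjective ?enum_uniq // -cardE cardB.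
Qed.

End MatroidFacts.

Theorem theorem2p1 (T : finType) (M : matroid T) (r n : nat)
    (rank_M : rank M = r) (card_T : #|T| = n)
    (loopless_M : loopless M)
    (not_free : ~ matroid_isomorphic M (uniform_matroid n n)) :
  hc (circuit_hypergraph M) = r.+1.
Proof.
rewrite /hc; case: ex_minnP => t forces_t min_t.
apply/eqP; rewrite eqn_leq; apply/andP; split.
  apply: min_t; rewrite -rank_M; apply/andP; split=> //.
  apply/forallP => phi; apply/implyP; exact: transversal_heterochromatic.
rewrite ltnNge; apply: contraL forces_t; rewrite -rank_M.
exact: not_forces_heterochromatic_le_rank.
Qed.
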